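(* Let $N\in\mathbb{N}$, write $N=2k$ or $N=2k+1$, let $w_0,\dotsc,w_{N-1}\ge0$, and consider a gathering Circulant Laplacian Dynamics (CLD) protocol with weight matrix $W=\operatorname{circ}(w_0,\dotsc,w_{N-1})$, i.e. the linear system on $\mathbb{R}^{2N}$ $$\dot Z=(-\mathbf{I}_{2N}+\mathbf{W})Z,\qquad \mathbf{W}=\begin{pmatrix}W&0\\0&W\end{pmatrix}.$$ Let $\lambda_j=\sum_{i=0}^{N-1}w_i\,e^{2\pi\mathbf{i}\,ij/N}$, and let $\mathbb{R}^{2N}=V_0\oplus\bigoplus_{j=1}^kV_j$ be the decomposition into the subspaces $V_j$ defined in the context. Let $Z(0)=(X(0),Y(0))\in\mathbb{R}^{2N}$ be an initial configuration. Then the solution $Z(t)$ with initial condition $Z(0)$ can be written as $$Z(t)=Z^*+\sum_{j=1}^k\alpha_j(t)\,\Xi_j(t),$$ where (i) $Z^*=(X^*,Y^* )=(x^*,\dotsc,x^*,y^*,\dotsc,y^* )$ is the final gathering point $\lim_{t\to\infty}Z(t)$; in particular $x^*=\frac1N\sum_{i=0}^{N-1}X_i(0)$ and $y^*=\frac1N\sum_{i=0}^{N-1}Y_i(0)$; (ii) $\alpha_j(t)=\exp\big((-1+\Re(\lambda_j))t\big)\in\mathbb{R}$ is the exponentially decaying coefficient corresponding to $\Xi_j(t)\in V_j$; (iii) $\Xi_j(t)=\mathcal{V}_j\beta_j(t)\in V_j$, where $\mathcal{V}_j$ is the matrix whose columns are the basis vectors of $V_j$ given in the context, for a time-dependent vector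 $\beta_j(t)\in\mathbb{R}^{\dim V_j}$ with constant norm, i.e. $\|\beta_j(t)\|_2=\|\beta_j(0)\|_2$ for all $t\ge0$.
   Context: $N$ robots with positions $z_i=(x_i,y_i)\in\mathbb{R}^2$, $i=0,\dotsc,N-1$, are collected in $Z=(X,Y)\in\mathbb{R}^{2N}$ with $X=(x_0,\dotsc,x_{N-1})$, $Y=(y_0,\dotsc,y_{N-1})$. The CLD protocol is $\dot z_i=-z_i+\sum_{j=0}^{N-1}w_jz_{i+j}$, indices modulo $N$; equivalently the system in the claim. $\operatorname{circ}(w_0,\dotsc,w_{N-1})$ is the circulant matrix with entries $W_{i,j}=w_{(j-i)\bmod N}$. All weights are non-negative (standing assumption). The protocol is called gathering if, for every initial configuration, the solution converges as $t\to\infty$ to a gathering point (there is $z^*\in\mathbb{R}^2$ with $z_i(t)\to z^*$ for all $i$) and if the system is in equilibrium in every gathering point ($\dot z_i=0$ for all $i$ whenever $z_0=\dotsb=z_{N-1}$). Let $\omega=\exp(2\pi\mathbf{i}/N)$ and $v_j=(1,\omega^j,\dotsc,\omega^{(N-1)j})^T\in\mathbb{C}^N$. The subspaces and their bases are: $V_0=\{(x^*,\dotsc,x^*,y^*,\dotsc,y^* ):x^*,y^*\in\mathbb{R}\}$; for $1\le j\le k$ (excluding $j=k$ when $N=2k$), $V_j$ is $4$-dimensional with basis $$\begin{pmatrix}\Re(v_j)\\-\Im(v_j)\end{pmatrix},\begin{pmatrix}\Im(v_j)\\ \Re(v_j)\end{pmatrix},\begin{pmatrix}-\Im(v_j)\\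 \Re(v_j)\end{pmatrix},\begin{pmatrix}\Re(v_j)\\ \Im(v_j)\end{pmatrix};$$ for $N=2k$ and $j=k$ the vector $v_k$ is real and $V_k$ is $2$-dimensional with basis $\begin{pmatrix}v_k\\ 0\end{pmatrix},\begin{pmatrix}0\\ v_k\end{pmatrix}$. Real and imaginary parts of vectors are taken entrywise. *)

(* Defs.v *)
From HB Require Import structures.
From mathcomp Require Import all_boot all_order all_algebra.
From mathcomp Require Import all_classical all_reals all_analysis.
From mathcomp Require Import complex.

Set Implicit Arguments.
Unset Strict Implicit.
Unset Printing Implicit Defensive.

Import Order.TTheory GRing.Theory Num.Theory.
Import numFieldNormedType.Exports.

Local Open Scope classical_set_scope.
Local Open Scope ring_scope.

(* There are N = n.+1 robots. A configuration Z = (X, Y) in R^(2N) is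
   a column vector with blocks X = usubmx Z and Y = dsubmx Z. *)

Section CLD.
Variables (R : realType) (n : nat).
Implicit Types (w : 'I_n.+1 -> R) (Z : R -> 'cV[R]_(n.+1 + n.+1)).

(* Subtraction in 'I_n.+1 is subtraction modulo n.+1. *)
Definition circ w : 'M[R]_n.+1 := \matrix_(i, j) w (j - i).

Definition cld_mx w : 'M[R]_(n.+1 + n.+1) :=
  - 1%:M + block_mx (circ w) 0 0 (circ w).

(* A solution on [0, +oo[; the values of Z at negative times are irrelevant,
   which is why the initial time is handled by continuity within [0, +oo[. *)
Definition cld_solution w (Z0 : 'cV[R]_(n.+1 + n.+1)) Z : Prop :=
  [/\ Z 0 = Z0,
      {within `[0, +oo[, continuous Z} &
      forall t : R, 0 < t -> is_derive t 1 Z (cld_mx w *m Z t)].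

Definition gathering_point (xs ys : R) : 'cV[R]_(n.+1 + n.+1) :=
  col_mx (const_mx xs) (const_mx ys).

Definition gathering w : Prop :=
  (forall (Z0 : 'cV[R]_(n.+1 + n.+1)) Z, cld_solution w Z0 Z ->
     exists xs ys : R, Z t @[t --> +oo] --> gathering_point xs ys) /\
  (forall xs ys : R, cld_mx w *m gathering_point xs ys = 0).

Definition cexp (z : R[i]) : R[i] :=
  Complex (expR (complex.Re z) * cos (complex.Im z))
          (expR (complex.Re z) * sin (complex.Im z)).

Definition lambda w (j : nat) : R[i] :=
  \sum_(i < n.+1)
    Complex (w i) 0 * cexp (Complex 0 (2 * pi * (i * j)%:R / n.+1%:R)).

Definition omega : R[i] := cexp (Complex 0 (2 * pi / n.+1%:R)).

Definition v (j : nat) : 'cV[R[i]]_n.+1 := \col_i omega ^+ (i * j).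

Definition Re_v (j : nat) : 'cV[R]_n.+1 := map_mx (@complex.Re R) (v j).
Definition Im_v (j : nat) : 'cV[R]_n.+1 := map_mx (@complex.Im R) (v j).

(* In the case N = 2j the vector v j is real, hence equal to Re_v j. *)
Definition basisV (j : nat) : seq 'cV[R]_(n.+1 + n.+1) :=
  if n.+1 == j.*2 then [:: col_mx (Re_v j) 0; col_mx 0 (Re_v j)]
  else [:: col_mx (Re_v j) (- Im_v j);
           col_mx (Im_v j) (Re_v j);
           col_mx (- Im_v j) (Re_v j);
           col_mx (Re_v j) (Im_v j)].

Definition dimV (j : nat) : nat := size (basisV j).

Definition V (j : nat) : {vspace 'cV[R]_(n.+1 + n.+1)} := <<basisV j>>%VS.

Definition Vmx (j : nat) : 'M[R]_(n.+1 + n.+1, dimV j) :=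
  \matrix_(i, c) (basisV j)`_c i 0.

Definition alpha w (j : nat) (t : R) : R :=
  expR ((-1 + complex.Re (lambda w j)) * t).

End CLD.

Arguments dimV R n j : clear implicits.
Arguments V R n j : clear implicits.
Arguments Vmx R n j : clear implicits.
Arguments gathering_point {R} n xs ys.

(* The library norm on matrices is the maximum norm. *)
Definition norm2 (R : realType) (d : nat) (b : 'cV[R]_d) : R :=
  Num.sqrt (\sum_(i < d) b i 0 ^+ 2).

(* Main.v *)
(* The discrete Fourier coefficients c_j of X (and of Y) diagonalise the
   circulant matrix: c_j' = (lambda_j - 1) c_j, hence
   c_j(t) = e^((lambda_j - 1) t) c_j(0), where the modulus contributes alpha_j
   and the phase e^(i Im(lambda_j) t) only rotates. As X is real,
   c_(N-j) is conjugate to c_j, so the modes j and N - j combine into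
   2 Re(c_j v_j). Equilibrium at gathering points forces sum_i w_i = 1, so c_0,
   the mean, is conserved and Re lambda_j <= 1. If Re lambda_j = 1, then
   omega^(ij) = 1 whenever w_i <> 0, so (Re v_j, 0) is a nonconstant equilibrium,
   contradicting gathering. *)

Require Import Defs.
From HB Require Import structures.
From mathcomp Require Import all_boot all_order all_algebra.
From mathcomp Require Import all_classical all_reals all_analysis.
From mathcomp Require Import complex.
From mathcomp Require Import ring lra zify.

Set Implicit Arguments.
Unset Strict Implicit.
Unset Printing Implicit Defensive.

Import Order.TTheory GRing.Theory Num.Theory.
Import numFieldNormedType.Exports.

Local Open Scope classical_set_scope.
Local Open Scope ring_scope.

(** * Folding sums that are symmetric under j -> N - j *)

(** The range 1, ..., N - 1 is cut after k and its upper part is reversed onto the lower one. For N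
    = 2k the index k is its own mirror image, so it is counted once. *)
Lemma big_fold_symmetric (V : zmodType) (N k : nat) (f : nat -> V) :
  N = k.*2 \/ N = k.*2.+1 -> (0 < N)%N ->
  (forall j, (0 < j < N)%N -> f (N - j)%N = f j) ->
  \sum_(0 <= j < N) f j =
    f 0%N + \sum_(1 <= j < k.+1) f j *+ (if N == j.*2 then 1 else 2).
Proof.
move=> hN N_gt0 fsym; rewrite big_ltn //; congr (_ + _).
case: hN fsym => ->.
  case: k => [|k] fsym; first by rewrite !big_geq.
  rewrite [RHS]big_nat_recr //= eqxx mulr1n.
  rewrite (@big_cat_nat _ _ _ k.+1) //=; last by lia.
  rewrite [X in _ + X]big_ltn; last by lia.
  rewrite addrCA [RHS]addrC; congr (_ + _).
  under [RHS]eq_big_nat => j hj.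
    have -> : (k.+1.*2 == j.*2) = false by apply/negbTE; lia.
    rewrite mulr2n.
  over.
  rewrite big_split /=; congr (_ + _).
  have -> : k.+2 = (1 + k.+1)%N by [].
  rewrite big_addn big_nat_rev /=.
  have -> : (k.+1.*2 - k.+1 = k.+1)%N by lia.
  apply: eq_big_nat => j hj; rewrite -fsym; last by lia.
  by congr (f _); lia.
move=> fsym; rewrite (@big_cat_nat _ _ _ k.+1) //=; last by lia.
under [RHS]eq_big_nat => j hj.
  have -> : (k.*2.+1 == j.*2) = false by apply/negbTE; lia.
  rewrite mulr2n.
over.
rewrite big_split /=; congr (_ + _).
have -> : k.+1 = (1 + k)%N by [].
rewrite big_addn big_nat_rev /=.
have -> : (k.*2.+1 - k = 1 + k)%N by lia.
apply: eq_big_nat => j hj; rewrite -fsym; last by lia.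
by congr (f _); lia.
Qed.

(** * The planar linear system with constant coefficients *)

(** The vector (a, b), rotated by -qt and scaled by e^(-pt), has zero derivative and is therefore
    constant; undoing rotation and scaling gives the formulas. *)
Lemma linear_planar_ode (R : realType) (p q : R) (a b : R -> R) :
  {within `[0, +oo[, continuous a} -> {within `[0, +oo[, continuous b} ->
  (forall t : R, 0 < t -> is_derive t 1 a (p * a t - q * b t)) ->
  (forall t : R, 0 < t -> is_derive t 1 b (q * a t + p * b t)) ->
  forall t : R, 0 <= t ->
    a t = expR (p * t) * (cos (q * t) * a 0 - sin (q * t) * b 0) /\
    b t = expR (p * t) * (sin (q * t) * a 0 + cos (q * t) * b 0).
Proof.
move=> ca cb da db t.
rewrite le_eqVlt => /predU1P[<-|t_gt0].
  by rewrite !mulr0 expR0 cos0 sin0; split; ring.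
have sub : `[0, t] `<=` `[0, +oo[.
  by move=> x /=; rewrite !in_itv /= => /andP[->].
have {}ca := continuous_subspaceW sub ca.
have {}cb := continuous_subspaceW sub cb.
have dlin (r x : R) : is_derive x 1 (fun s : R => r * s) r.
  by apply: is_derive_eq; rewrite /GRing.scale /= mulr1.
have dexp (x : R) : is_derive x 1 (fun s : R => expR (- p * s))
    (- p * expR (- p * x)).
  have := @is_derive1_comp _ expR (fun s : R => - p * s) x _ _
    (is_derive_expR _) (dlin _ _).
  by rewrite mulrC.
have dcos (x : R) : is_derive x 1 (fun s : R => cos (q * s))
    (- q * sin (q * x)).
  have := @is_derive1_comp _ cos (fun s : R => q * s) x _ _
    (is_derive_cos _) (dlin _ _).
  by rewrite mulNr mulrC -mulNr mulrC.
have dsin (x : R) : is_derive x 1 (fun s : R => sin (q * s))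
    (q * cos (q * x)).
  have := @is_derive1_comp _ sin (fun s : R => q * s) x _ _
    (is_derive_sin _) (dlin _ _).
  by rewrite mulrC.
(* The mean value theorem on [0, t] requires the derivative only in the open interval; at the end
   point 0 continuity suffices. *)
have cstf (u v : R -> R) :
  (forall x, derivable u x 1) -> (forall x, derivable v x 1) ->
  (forall x : R, 0 < x -> is_derive x 1 (u * a + v * b) 0) ->
  u t * a t + v t * b t = u 0 * a 0 + v 0 * b 0.
  move=> du dv duv.
  have cont (g : R -> R) : (forall x, derivable g x 1) ->
      {within `[0, t], continuous g}.
    move=> dg; apply: continuous_subspaceT => x.
    by apply: differentiable_continuous; apply/derivable1_diffP.
  have [] := @MVT R (u * a + v * b) (cst 0) 0 t t_gt0.
  - move=> x; rewrite in_itv /= => /andP[x0 _]; exact: duv.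
  - move=> x; apply: continuousD; apply: continuousM.
    + exact: cont.
    + exact: ca.
    + exact: cont.
    + exact: cb.
  by move=> c _; rewrite /= mul0r => /eqP; rewrite subr_eq0 => /eqP.
have d1 : forall x : R, derivable (fun s : R => expR (- p * s)) x 1.
  by move=> x; exact: ex_derive.
have d2 : forall x : R, derivable (fun s : R => cos (q * s)) x 1.
  by move=> x; exact: ex_derive.
have d3 : forall x : R, derivable (fun s : R => sin (q * s)) x 1.
  by move=> x; exact: ex_derive.
(* [e1] and [e2] are the two coordinates of the conserved vector. *)
have e1 : expR (- p * t) * (cos (q * t) * a t + sin (q * t) * b t) = a 0.
  pose u : R -> R := (fun s => expR (- p * s)) * (fun s => cos (q * s)).
  pose v : R -> R := (fun s => expR (- p * s)) * (fun s => sin (q * s)).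
  have du (x : R) : derivable u x 1 by apply: derivableM.
  have dv (x : R) : derivable v x 1 by apply: derivableM.
  have duv (x : R) : 0 < x -> is_derive x 1 (u * a + v * b) 0.
    move=> x0; have := da x x0; have := db x x0 => {}db {}da.
    by apply: is_derive_eq; rewrite /GRing.scale /= /u /v !fctE; ring.
  have := cstf u v du dv duv.
  rewrite /u /v !fctE !mulr0 expR0 cos0 sin0 mulr1 mul1r mulr0 mul0r addr0.
  by move=> <-; ring.
have e2 : expR (- p * t) * (cos (q * t) * b t - sin (q * t) * a t) = b 0.
  pose u : R -> R := (fun s => expR (- p * s)) * (- (fun s => sin (q * s))).
  pose v : R -> R := (fun s => expR (- p * s)) * (fun s => cos (q * s)).
  have du (x : R) : derivable u x 1 by apply: derivableM => //; exact: derivableN.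
  have dv (x : R) : derivable v x 1 by apply: derivableM.
  have duv (x : R) : 0 < x -> is_derive x 1 (u * a + v * b) 0.
    move=> x0; have := da x x0; have := db x x0 => {}db {}da.
    by apply: is_derive_eq; rewrite /GRing.scale /= /u /v !fctE; ring.
  have := cstf u v du dv duv.
  rewrite /u /v !fctE !mulr0 expR0 cos0 sin0 oppr0 mulr1 mul1r mulr0 mul0r add0r.
  by move=> <-; ring.
(* The rotation is inverted using only cos^2 + sin^2 = 1 and e^(pt) e^(-pt) = 1. *)
rewrite -e1 -e2.
have eE : expR (p * t) * expR (- p * t) = 1 by rewrite -expRD mulNr subrr expR0.
have cs := cos2Dsin2 (q * t).
move: (cos _) (sin _) (expR (- p * t)) (expR (p * t)) cs eE => c s f e cs ef.
split.
  transitivity ((e * f) * (c ^+ 2 + s ^+ 2) * a t); last by ring.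
  by rewrite ef cs !mul1r.
transitivity ((e * f) * (c ^+ 2 + s ^+ 2) * b t); last by ring.
by rewrite ef cs !mul1r.
Qed.

(** * Real parts, imaginary parts and conjugates; a bound on the cosine *)

Lemma ReD (R : realType) (x y : R[i]) :
  complex.Re (x + y) = complex.Re x + complex.Re y.
Proof. by case: x y => [a b] [c d]. Qed.

Lemma ImD (R : realType) (x y : R[i]) :
  complex.Im (x + y) = complex.Im x + complex.Im y.
Proof. by case: x y => [a b] [c d]. Qed.

Lemma ReM (R : realType) (x y : R[i]) : complex.Re (x * y) =
  complex.Re x * complex.Re y - complex.Im x * complex.Im y.
Proof. by case: x y => [a b] [c d]. Qed.

Lemma ImM (R : realType) (x y : R[i]) : complex.Im (x * y) =
  complex.Re x * complex.Im y + complex.Im x * complex.Re y.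
Proof. by case: x y => [a b] [c d]. Qed.

Lemma Re_sum (R : realType) (I : Type) (r : seq I) (P : pred I)
    (F : I -> R[i]) :
  complex.Re (\sum_(i <- r | P i) F i) = \sum_(i <- r | P i) complex.Re (F i).
Proof. by apply: big_morph => // x y; exact: ReD. Qed.

Lemma Im_sum (R : realType) (I : Type) (r : seq I) (P : pred I)
    (F : I -> R[i]) :
  complex.Im (\sum_(i <- r | P i) F i) = \sum_(i <- r | P i) complex.Im (F i).
Proof. by apply: big_morph => // x y; exact: ImD. Qed.

(** By the half-angle formula cos x = 1 - 2 sin^2(x/2), where x/2 lies strictly between 0 and pi. *)
Lemma cos_lt1 (R : realType) (x : R) : 0 < x < 2 * pi -> cos x < 1.
Proof.
move=> /andP[x0 x2]; have -> : x = (x / 2) *+ 2 by rewrite -mulr_natr mulfVK.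
have s0 : 0 < sin (x / 2) by apply: sin_gt0_pi; apply/andP; split; lra.
have := cos2Dsin2 (x / 2); rewrite mulr2n cosD => cs.
have : 0 < sin (x / 2) ^+ 2 by rewrite exprn_gt0.
rewrite -!expr2; lra.
Qed.

Lemma conjcM (R : realType) (x y : R[i]) : conjc (x * y) = conjc x * conjc y.
Proof. exact: rmorphM. Qed.

Lemma conjcX (R : realType) (x : R[i]) (m : nat) :
  conjc (x ^+ m) = conjc x ^+ m.
Proof. exact: rmorphXn. Qed.

Lemma conjc_sum (R : realType) (m : nat) (F : 'I_m -> R[i]) :
  conjc (\sum_(i < m) F i) = \sum_(i < m) conjc (F i).
Proof. exact: rmorph_sum. Qed.

(** * Roots of unity and the discrete Fourier transform *)

Section Fourier.
Variables (R : realType) (n : nat).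
Implicit Types (X : 'cV[R]_n.+1) (w : 'I_n.+1 -> R).

Local Notation N := n.+1.
Local Notation om := (omega R n).
Local Notation om' := (conjc (omega R n)).

Lemma cexp_i (x : R) : cexp (Complex 0 x) = Complex (cos x) (sin x).
Proof. by rewrite /cexp /= expR0 !mul1r. Qed.

Lemma omegaX (m : nat) :
  om ^+ m = Complex (cos (2 * pi * m%:R / N%:R)) (sin (2 * pi * m%:R / N%:R)).
Proof.
elim: m => [|m IH]; first by rewrite expr0 !(mulr0, mul0r) cos0 sin0.
rewrite exprS IH /omega cexp_i.
have -> : 2 * pi * m.+1%:R / N%:R = 2 * pi / N%:R + 2 * pi * m%:R / N%:R :> R.
  by rewrite -natr1; ring.
by rewrite cosD sinD; congr Complex; ring.
Qed.

Lemma omegaN : om ^+ N = 1.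
Proof.
rewrite omegaX mulfK ?pnatr_eq0 //.
have -> : 2 * pi = pi *+ 2 :> R by rewrite mulrC mulr_natr.
by rewrite cos2pi mulr2n sinD sinpi mulr0 mul0r addr0.
Qed.

Lemma omega_angle (m : nat) : (0 < m < N)%N ->
  0 < (2 * pi * m%:R / N%:R : R) < 2 * pi.
Proof.
move=> /andP[m0 mN]; have p0 := pi_gt0 R.
have N0 : 0 < N%:R :> R by rewrite ltr0n.
have m0' : 0 < m%:R :> R by rewrite ltr0n.
have mN' : m%:R < N%:R :> R by rewrite ltr_nat.
apply/andP; split; first by rewrite divr_gt0 // mulr_gt0 //; lra.
by rewrite ltr_pdivrMr // ltr_pM2l //; lra.
Qed.

Lemma Re_omegaX_lt1 (m : nat) : (0 < m < N)%N -> complex.Re (om ^+ m) < 1.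
Proof. by move=> /omega_angle hm; rewrite omegaX; exact: cos_lt1. Qed.

(** If the order m were less than N, the real part of omega^m = 1 would be less than 1. *)
Lemma omega_prim : N.-primitive_root om.
Proof.
have [m prim_m mN] := prim_order_exists (ltn0Sn n) omegaN.
have [<- //|neq] := eqVneq m N.
have m_gt0 := prim_order_gt0 prim_m.
have mltN : (m < N)%N by rewrite ltn_neqAle neq dvdn_leq.
have := @Re_omegaX_lt1 m; rewrite m_gt0 mltN (prim_expr_order prim_m) /=.
by rewrite ltxx => /(_ isT).
Qed.

Lemma omega_conj : om * om' = 1.
Proof.
rewrite /omega cexp_i /=; apply/eqP; rewrite eq_complex /=; apply/andP.
split; apply/eqP; last by ring.
by rewrite -[RHS](cos2Dsin2 (2 * pi / N%:R)); ring.
Qed.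

Lemma omega_conjX (m : nat) : om ^+ m * om' ^+ m = 1.
Proof. by rewrite -exprMn omega_conj expr1n. Qed.

Lemma omega'N : om' ^+ N = 1.
Proof. by have := omega_conjX N; rewrite omegaN mul1r. Qed.

(** Orthogonality of characters: a geometric sum with ratio z, where z^N = 1, and z = 1 only for i =
    l because omega is primitive. *)
Lemma sum_omega (i l : 'I_N) :
  \sum_(j < N) om' ^+ (i * j) * om ^+ (l * j) = (N * (i == l))%:R.
Proof.
pose z := om' ^+ i * om ^+ l.
have zE j : om' ^+ (i * j) * om ^+ (l * j) = z ^+ j.
  by rewrite /z exprMn -!exprM.
under eq_bigr do rewrite zE.
have [il|il] := eqVneq i l.
  have -> : z = 1 by rewrite /z il mulrC omega_conjX.
  under eq_bigr do rewrite expr1n.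
  by rewrite sumr_const card_ord muln1.
have zN : z ^+ N = 1.
  by rewrite /z exprMn -!exprM ![(_ * N)%N]mulnC !exprM omegaN omega'N !expr1n mulr1.
have z1 : z != 1.
  apply: contra_neq il => z1; apply/val_inj/eqP.
  have : om ^+ i == om ^+ l.
    by rewrite -[om ^+ l]mul1r -(omega_conjX i) -mulrA -/z z1 mulr1.
  by rewrite (eq_prim_root_expr omega_prim) !modn_small.
have := subrX1 z N; rewrite zN subrr => /esym/eqP.
by rewrite mulf_eq0 subr_eq0 (negbTE z1) /= muln0 => /eqP.
Qed.

(** The coefficient c_j. The factor 1/N is placed here so that the inversion formula has none. *)
Definition dft X (j : nat) : R[i] :=
  N%:R^-1 * \sum_(i < N) (X i 0)%:C%C * om' ^+ (i * j).

Lemma dft_inversion X (l : 'I_N) :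
  (X l 0)%:C%C = \sum_(j < N) dft X j * om ^+ (l * j).
Proof.
rewrite /dft; under eq_bigr do rewrite -mulrA mulr_suml.
rewrite -mulr_sumr exchange_big /=.
under eq_bigr => i _.
  under eq_bigr do rewrite -mulrA.
  rewrite -mulr_sumr sum_omega.
over.
rewrite (bigD1 l) //= big1 => [|i il]; last by rewrite (negbTE il) muln0 mulr0.
by rewrite eqxx muln1 addr0 mulrC mulfK // pnatr_eq0.
Qed.

Lemma omega_sub (i j : nat) : (j <= N)%N -> om' ^+ (i * (N - j)) = om ^+ (i * j).
Proof.
move=> jN; rewrite -[LHS]mul1r -(omega_conjX (i * j)) -mulrA -exprD -mulnDr.
by rewrite subnKC // [(i * N)%N]mulnC [X in _ * X]exprM omega'N expr1n mulr1.
Qed.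

(** The entries of X are real, and the conjugate of omega is its inverse. *)
Lemma dft_conj X (j : nat) : (j <= N)%N -> dft X (N - j) = conjc (dft X j).
Proof.
move=> jN; rewrite /dft conjcM conjc_inv conjc_nat conjc_sum.
congr (_ * _); apply: eq_bigr => i _.
by rewrite conjcM conjcX conjcK conjc_real omega_sub.
Qed.

Lemma lambdaE w (j : nat) :
  lambda w j = \sum_(i < N) (w i)%:C%C * om ^+ (i * j).
Proof. by apply: eq_bigr => i _; rewrite cexp_i omegaX. Qed.

(** Addition of indices is modulo N, which z^N = 1 makes harmless in exponents. *)
Lemma expr_ordD (T : pzRingType) (z : T) (a b : 'I_N) (j : nat) : z ^+ N = 1 ->
  z ^+ ((a + b)%R * j) = z ^+ (a * j) * z ^+ (b * j).
Proof.
by move=> zN; rewrite exprM expr_mod // -exprM mulnDl exprD.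
Qed.

(** The convolution theorem: since the entry at (i, l) is w_(l-i), putting m = l - i splits the
    double sum into a sum over m, which is lambda_j, and a sum over l. *)
Lemma dft_circ w X (j : nat) : dft (circ w *m X) j = lambda w j * dft X j.
Proof.
rewrite /dft mulrCA; congr (_ * _).
transitivity (\sum_(l < N) \sum_(i < N)
    (w (l - i))%:C%C * (X l 0)%:C%C * om' ^+ (i * j)).
  rewrite exchange_big; apply: eq_bigr => i _.
  rewrite mxE rmorph_sum mulr_suml; apply: eq_bigr => l _.
  by rewrite mxE rmorphM.
rewrite lambdaE mulr_sumr; apply: eq_bigr => l _.
rewrite mulr_suml (reindex_inj (inv_inj (subKr l))) /=.
apply: eq_bigr => m _; rewrite subKr.
have -> : om' ^+ (l * j) = om' ^+ (((l - m)%R : 'I_N) * j) * om' ^+ (m * j).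
  by rewrite -(expr_ordD _ _ _ omega'N) subrK.
rewrite -[LHS]mulr1 -(omega_conjX (m * j)); ring.
Qed.

(** A real linear combination of the coordinates, so that continuity, derivatives and limits pass
    from the coordinates to c_j. *)
Lemma Re_dft X (j : nat) : complex.Re (dft X j) =
  \sum_(i < N) complex.Re (N%:R^-1 * om' ^+ (i * j)) * X i 0.
Proof.
rewrite /dft mulr_sumr Re_sum; apply: eq_bigr => i _.
by rewrite mulrCA ReM /= mul0r subr0 mulrC.
Qed.

Lemma Im_dft X (j : nat) : complex.Im (dft X j) =
  \sum_(i < N) complex.Im (N%:R^-1 * om' ^+ (i * j)) * X i 0.
Proof.
rewrite /dft mulr_sumr Im_sum; apply: eq_bigr => i _.
by rewrite mulrCA ImM /= mul0r addr0 mulrC.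
Qed.

Lemma dftB X Y (j : nat) : dft (X - Y) j = dft X j - dft Y j.
Proof.
rewrite /dft -mulrBr -sumrB; congr (_ * _); apply: eq_bigr => i _.
by rewrite !mxE rmorphB mulrBl.
Qed.

Lemma dft0 X : dft X 0 = (N%:R^-1 * \sum_(i < N) X i 0)%:C%C.
Proof.
rewrite /dft rmorphM fmorphV rmorph_nat rmorph_sum; congr (_ * _).
by apply: eq_bigr => i _; rewrite muln0 expr0 mulr1.
Qed.

(** In the inversion formula the terms j and N - j are conjugate and so have equal real parts; the
    sum folds to j <= k. *)
Lemma fourier_real (k : nat) X (i : 'I_N) : N = k.*2 \/ N = k.*2.+1 ->
  X i 0 = complex.Re (dft X 0) +
    \sum_(1 <= j < k.+1) complex.Re (dft X j * om ^+ (i * j)) *+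
      (if N == j.*2 then 1 else 2).
Proof.
move=> hk; have /(congr1 (@complex.Re R)) := dft_inversion X i.
rewrite Re_sum /= => ->.
rewrite -(big_mkord xpredT (fun j => complex.Re (dft X j * om ^+ (i * j)))).
rewrite (big_fold_symmetric hk) //; first by rewrite muln0 expr0 mulr1.
move=> j /andP[j0 jN]; rewrite dft_conj 1?ltnW //.
have -> : om ^+ (i * (N - j)) = conjc (om ^+ (i * j)).
  rewrite conjcX -[LHS]mulr1 -(omega_conjX (i * j)) mulrA -exprD -mulnDr.
  by rewrite subnK 1?ltnW // [(i * N)%N]mulnC exprM omegaN expr1n mul1r.
by rewrite -conjcM; case: (_ * _).
Qed.

End Fourier.

(** * Derivatives and limits of coordinates and linear combinations *)

Lemma is_derive_coord (R : realType) (m p : nat) (Z : R -> 'M[R]_(m, p))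
    (D : 'M[R]_(m, p)) (t : R) (i : 'I_m) (j : 'I_p) :
  is_derive t 1 Z D -> is_derive t 1 (fun s => Z s i j) (D i j).
Proof.
move=> [dZ ZD]; apply: DeriveDef; first by move/derivable_mxP: dZ.
by rewrite -ZD derive_mx // mxE.
Qed.

Lemma is_derive_lincomb (R : realType) (m : nat) (c : 'I_m -> R)
    (f : 'I_m -> R -> R) (df : 'I_m -> R) (t : R) :
  (forall i, is_derive t 1 (f i) (df i)) ->
  is_derive t 1 (fun s => \sum_(i < m) c i * f i s) (\sum_(i < m) c i * df i).
Proof.
move=> dfi.
have := @is_derive_sum _ _ _ m (fun i => c i \*: f i) t 1 (fun i => c i *: df i)
  (fun i => is_deriveZ _ (dfi i)).
by rewrite fct_sumE.
Qed.

(** A general filter covers both continuity within [0, +oo[ and limits at +oo. *)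
Lemma cvg_lincomb (R : realType) (T : Type) (F : set_system T) (FF : Filter F)
    (m : nat) (c : 'I_m -> R) (f : 'I_m -> T -> R) (l : 'I_m -> R) :
  (forall i, f i x @[x --> F] --> l i) ->
  \sum_(i < m) c i * f i x @[x --> F] --> \sum_(i < m) c i * l i.
Proof.
move=> fl; elim: (index_enum _) => [|i r IH].
  by rewrite big_nil; under eq_fun do rewrite big_nil; exact: cvg_cst.
rewrite big_cons; under eq_fun do rewrite big_cons.
by apply: cvgD; [apply: cvgMr; exact: fl|exact: IH].
Qed.

(** * Time evolution of the Fourier coefficients *)

Section Dynamics.
Variables (R : realType) (n : nat).
Implicit Types (w : 'I_n.+1 -> R) (X : R -> 'cV[R]_n.+1).

Local Notation N := n.+1.

(** Here N - j = j, so omega^(ij) equals its own conjugate. *)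
Lemma Im_omega_half (i j : nat) : N = j.*2 ->
  complex.Im (omega R n ^+ (i * j)) = 0.
Proof.
move=> Nj; have jN : (j <= N)%N by lia.
have := omega_sub R i jN; have -> : (N - j = j)%N by lia.
rewrite -conjcX; case: (_ ^+ _) => a b /= [] /eqP.
by rewrite -subr_eq0 -opprD oppr_eq0 -mulr2n mulrn_eq0 /= => /eqP.
Qed.

Lemma Im_lambda_half w (j : nat) : N = j.*2 -> complex.Im (lambda w j) = 0.
Proof.
move=> Nj; rewrite lambdaE Im_sum big1 // => i _.
by rewrite ImM /= Im_omega_half // mulr0 mul0r addr0.
Qed.

(** The first row of the equilibrium condition at the gathering point (1, 0); row 0 of [circ w]
    lists all the weights. *)
Lemma gathering_sum w : gathering w -> \sum_i w i = 1.
Proof.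
move=> [_ /(_ 1 0) /matrixP/(_ (lshift _ ord0) ord0)].
rewrite /cld_mx /gathering_point mulmxDl mulNmx mul1mx mul_block_col.
rewrite !mul0mx addr0 !mxE.
rewrite !(unsplitK (inl ord0)) !mxE.
move=> /eqP; rewrite addrC subr_eq0 => /eqP <-; apply: eq_bigr => i _.
by rewrite !mxE mulr1 subr0.
Qed.

Lemma lambda0 w : lambda w 0 = (\sum_i w i)%:C%C.
Proof.
rewrite lambdaE rmorph_sum; apply: eq_bigr => i _.
by rewrite muln0 expr0 mulr1.
Qed.

(** The equation c_j' = (lambda_j - 1) c_j, written for real and imaginary parts, is the planar
    system with p = -1 + Re lambda_j and q = Im lambda_j. *)
Lemma dft_solution w X :
  (forall i, {within `[0, +oo[, continuous (fun t => X t i 0)}) ->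
  (forall t : R, 0 < t -> forall i,
    is_derive t 1 (fun s => X s i 0) ((circ w *m X t - X t) i 0)) ->
  forall (j : nat) (t : R), 0 <= t ->
    dft (X t) j = (alpha w j t)%:C%C *
      (cexp (Complex 0 (complex.Im (lambda w j) * t)) * dft (X 0) j).
Proof.
move=> cX dX j t t_ge0.
have dE s : dft (circ w *m X s - X s) j = (lambda w j - 1) * dft (X s) j.
  by rewrite dftB dft_circ mulrBl mul1r.
have ReE : (fun s => complex.Re (dft (X s) j)) = fun s =>
    \sum_(i < N) complex.Re (N%:R^-1 * conjc (omega R n) ^+ (i * j)) * X s i 0.
  by apply/funext => s; exact: Re_dft.
have ImE : (fun s => complex.Im (dft (X s) j)) = fun s =>
    \sum_(i < N) complex.Im (N%:R^-1 * conjc (omega R n) ^+ (i * j)) * X s i 0.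
  by apply/funext => s; exact: Im_dft.
have [||||Re_eq Im_eq] := @linear_planar_ode R (-1 + complex.Re (lambda w j))
  (complex.Im (lambda w j)) (fun t => complex.Re (dft (X t) j))
  (fun t => complex.Im (dft (X t) j)) _ _ _ _ t t_ge0.
- rewrite ReE; move=> s; apply: cvg_lincomb => i; exact: cX.
- rewrite ImE; move=> s; apply: cvg_lincomb => i; exact: cX.
- move=> {t_ge0}t t0; have -> : (-1 + complex.Re (lambda w j)) *
      complex.Re (dft (X t) j) - complex.Im (lambda w j) *
      complex.Im (dft (X t) j) = complex.Re (dft (circ w *m X t - X t) j).
    by rewrite dE (ReM (lambda w j - 1)) ReD ImD /=; ring.
  rewrite ReE.
  by rewrite Re_dft; apply: is_derive_lincomb => i; exact: dX.
- move=> {t_ge0}t t0; have -> : complex.Im (lambda w j) *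
      complex.Re (dft (X t) j) + (-1 + complex.Re (lambda w j)) *
      complex.Im (dft (X t) j) = complex.Im (dft (circ w *m X t - X t) j).
    by rewrite dE (ImM (lambda w j - 1)) ReD ImD /=; ring.
  rewrite ImE.
  by rewrite Im_dft; apply: is_derive_lincomb => i; exact: dX.
apply/eqP; rewrite eq_complex; apply/andP; split; apply/eqP.
  by rewrite (ReM (_%:C)%C) Re_eq cexp_i /= mul0r subr0 (ReM (Complex _ _)).
rewrite (ImM (_%:C)%C) Im_eq cexp_i /= mul0r addr0 (ImM (Complex _ _)).
by congr (_ * _); exact: addrC.
Qed.
End Dynamics.

(** * Rotating modes and their coordinates in V_j *)

Section Modes.
Variables (R : realType) (n : nat).
Implicit Types (w : 'I_n.+1 -> R) (X : 'cV[R]_n.+1).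

Local Notation N := n.+1.

(** With X the initial block, this is c_j(t) without its decay factor alpha_j(t). *)
Definition mode w X (j : nat) (t : R) : R[i] :=
  cexp (Complex 0 (complex.Im (lambda w j) * t)) * dft X j.

(** Both lambda_j and c_j are real, so there is no rotation. *)
Lemma mode_half w X (j : nat) (t : R) : N = j.*2 ->
  complex.Im (mode w X j t) = 0 /\ mode w X j t = mode w X j 0.
Proof.
move=> Nj; rewrite /mode Im_lambda_half // !mul0r cexp_i cos0 sin0.
split => //; rewrite mul1r Im_dft big1 // => i _.
have -> : conjc (omega R n) ^+ (i * j) = conjc (omega R n ^+ (i * j)).
  by rewrite conjcX.
have := @Im_omega_half R n i j Nj; case: (omega R n ^+ (i * j)) => a b /= ->.
rewrite ImM /= oppr0 mulr0 add0r.
have -> : N%:R^-1 = (N%:R^-1)%:C%C :> R[i] by rewrite fmorphV rmorph_nat.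
by rewrite /= !mul0r.
Qed.

Lemma mode_norm w X (j : nat) (t : R) :
  complex.Re (mode w X j t) ^+ 2 + complex.Im (mode w X j t) ^+ 2 =
  complex.Re (dft X j) ^+ 2 + complex.Im (dft X j) ^+ 2.
Proof.
rewrite /mode cexp_i; have cs := cos2Dsin2 (complex.Im (lambda w j) * t).
rewrite (ReM (Complex _ _)) (ImM (Complex _ _)) /=.
by rewrite -[RHS]mul1r -[in RHS]cs; ring.
Qed.

(* Coordinates in [basisV] of the vector with blocks m Re(d v_j) and
   m Re(e v_j), where m = 1 if N = 2j and m = 2 otherwise. *)
Definition coords (j : nat) (d e : R[i]) : seq R :=
  if N == j.*2 then [:: complex.Re d; complex.Re e]
  else [:: complex.Re d + complex.Im e; complex.Re e - complex.Im d;
           complex.Re e + complex.Im d; complex.Re d - complex.Im e].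

(** [coords] has length [dimV] in both cases, so the default of the lookup is never reached. *)
Definition coord_col (j : nat) (d e : R[i]) : 'cV[R]_(dimV R n j) :=
  \col_c (coords j d e)`_c.

Lemma Vmx_mul (j : nat) (b : 'cV[R]_(dimV R n j)) :
  Vmx R n j *m b = \sum_c b c 0 *: (basisV R n j)`_c.
Proof.
apply/colP => i; rewrite !mxE summxE; apply: eq_bigr => c _.
by rewrite !mxE mulrC.
Qed.

Lemma Vmx_mul_in_V (j : nat) (b : 'cV[R]_(dimV R n j)) :
  Vmx R n j *m b \in V R n j.
Proof.
rewrite Vmx_mul; apply: memv_suml => c _; apply/memvZ/memv_span/mem_nth.
exact: ltn_ord.
Qed.

(** For coordinates b1, ..., b4 the upper block is (b1 + b4) Re v_j + (b2 - b3) Im v_j, with b1 + b4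
    = 2 Re d and b2 - b3 = -2 Im d; the lower block is similar with e. If N = 2j the basis contains
    only Re v_j, hence d and e must be real. *)
Lemma Vmx_coord_col (j : nat) (d e : R[i]) :
  (N = j.*2 -> complex.Im d = 0 /\ complex.Im e = 0) ->
  Vmx R n j *m coord_col j d e =
    col_mx (\col_i complex.Re (d * omega R n ^+ (i * j)))
           (\col_i complex.Re (e * omega R n ^+ (i * j)))
      *+ (if N == j.*2 then 1 else 2).
Proof.
move=> hIm; rewrite Vmx_mul.
under eq_bigr do rewrite mxE.
rewrite -(big_mkord xpredT (fun c => (coords j d e)`_c *: (basisV R n j)`_c)).
rewrite /dimV /coords /basisV; case: eqP hIm => [Nj /(_ Nj)[Imd Ime]|_ _].
  rewrite /= !big_nat_recr //= big_geq // add0r mulr1n.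
  rewrite !scale_col_mx !scaler0 add_col_mx add0r addr0.
  by congr col_mx; apply/colP => i; rewrite !mxE ReM ?Imd ?Ime mul0r subr0.
rewrite /= !big_nat_recr //= big_geq // add0r mulr2n.
rewrite !scale_col_mx !add_col_mx.
by congr col_mx; apply/colP => i; rewrite !mxE !ReM; ring.
Qed.

(** In the four-dimensional case the cross terms cancel in pairs, leaving 2(|d|^2 + |e|^2), which
    rotations of d and e preserve. *)
Lemma norm2_coord_col (j : nat) (d e : R[i]) :
  norm2 (coord_col j d e) = Num.sqrt (
    if N == j.*2 then complex.Re d ^+ 2 + complex.Re e ^+ 2
    else ((complex.Re d ^+ 2 + complex.Im d ^+ 2) +
          (complex.Re e ^+ 2 + complex.Im e ^+ 2)) *+ 2).
Proof.
congr Num.sqrt; under eq_bigr do rewrite mxE.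
rewrite -(big_mkord xpredT (fun c => (coords j d e)`_c ^+ 2)).
rewrite /dimV /coords /basisV; case: eqP => _.
  by rewrite /= !big_nat_recr //= big_geq // add0r.
rewrite /= !big_nat_recr //= big_geq // add0r; ring.
Qed.

Lemma norm2_coord_col_mode w X Y (j : nat) (t : R) :
  norm2 (coord_col j (mode w X j t) (mode w Y j t)) =
  norm2 (coord_col j (mode w X j 0) (mode w Y j 0)).
Proof.
rewrite !norm2_coord_col !mode_norm; case: eqP => // Nj.
by have [_ ->] := mode_half w X t Nj; have [_ ->] := mode_half w Y t Nj.
Qed.

End Modes.

(** * Consequences of gathering: strict decay and conservation of the mean *)

Section Gathering.
Variables (R : realType) (n : nat) (w : 'I_n.+1 -> R).
Hypothesis w_ge0 : forall i, 0 <= w i.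
Hypothesis hw : gathering w.

Local Notation N := n.+1.

Lemma cld_mx_mul (Z : 'cV[R]_(N + N)) : cld_mx w *m Z =
  col_mx (circ w *m usubmx Z - usubmx Z) (circ w *m dsubmx Z - dsubmx Z).
Proof.
rewrite -{1}[Z]vsubmxK mulmxDl mulNmx mul1mx mul_block_col.
by rewrite !mul0mx addr0 add0r opp_col_mx add_col_mx ![- _ + _]addrC.
Qed.

Lemma cld_solution_cst (Z : 'cV[R]_(N + N)) :
  cld_mx w *m Z = 0 -> cld_solution w Z (cst Z).
Proof.
move=> Z0; split=> //.
  by apply: continuous_subspaceT => t; exact: cst_continuous.
by move=> t _; rewrite /= Z0; exact: is_derive_cst.
Qed.

(** Re lambda_j is an average of cosines with weights w_i, hence at most 1; equality is refuted by
    an equilibrium that is not a gathering point. *)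
Lemma Re_lambda_lt1 (j : nat) : (0 < j < N)%N -> complex.Re (lambda w j) < 1.
Proof.
move=> jN; have sum_w := gathering_sum hw.
have cos_le (i : nat) : complex.Re (omega R n ^+ i) <= 1.
  by rewrite omegaX /= cos_le1.
have ReE : complex.Re (lambda w j) =
    \sum_i w i * complex.Re (omega R n ^+ (i * j)).
  by rewrite lambdaE Re_sum; apply: eq_bigr => i _; rewrite ReM /= mul0r subr0.
have term_le (i : 'I_N) : w i * complex.Re (omega R n ^+ (i * j)) <= w i.
  by rewrite ler_piMr.
rewrite lt_neqAle; apply/andP; split; last first.
  by rewrite ReE -sum_w; apply: ler_sum => i _.
apply/eqP => Re1.
(* A sum of non-negative differences vanishes only termwise. Where w_i is nonzero the cosine is 1,
   so the sine is 0. *)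
have tight (i : 'I_N) : w i = 0 \/ omega R n ^+ (i * j) = 1.
  have : w i - w i * complex.Re (omega R n ^+ (i * j)) = 0.
    have /eqP := Re1; rewrite ReE -sum_w eq_sym -subr_eq0 -sumrB.
    rewrite psumr_eq0 => [/allP/(_ i)|k _]; last by rewrite subr_ge0.
    by rewrite mem_index_enum /= => /(_ isT)/eqP.
  rewrite -{1}[w i]mulr1 -mulrBr => /eqP; rewrite mulf_eq0 => /orP[/eqP|].
    by left.
  rewrite subr_eq0 eq_sym => /eqP; rewrite omegaX /= => c1; right.
  have := cos2Dsin2 (2 * pi * (i * j)%:R / N%:R : R); rewrite c1 expr1n.
  by move=> /eqP; rewrite -subr_eq0 addrAC subrr add0r sqrf_eq0 => /eqP ->.
(* Row i averages only entries l with omega^((l-i)j) = 1, and these all equal entry i. *)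
have fixed : circ w *m Re_v R n j = Re_v R n j.
  apply/colP => i; rewrite !mxE.
  transitivity (\sum_(l < N) w (l - i) * complex.Re (omega R n ^+ (i * j))).
    apply: eq_bigr => l _; rewrite !mxE.
    have [->|e] := tight (l - i); first by rewrite !mul0r.
    congr (_ * complex.Re _).
    by rewrite -{1}[l](subrK i) (expr_ordD _ _ _ (omegaN R n)) e mul1r.
  rewrite -mulr_suml (reindex_inj (addIr i)) /=.
  by under eq_bigr do rewrite addrK; rewrite sum_w mul1r.
pose Z : 'cV[R]_(N + N) := col_mx (Re_v R n j) 0.
have ZM : cld_mx w *m Z = 0.
  by rewrite cld_mx_mul col_mxKu col_mxKd fixed mulmx0 !subrr col_mx0.
have [xs [ys Zlim]] := hw.1 _ _ (cld_solution_cst ZM).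
have Zgp : Z = gathering_point n xs ys.
  by apply: (cvg_unique _ (cvg_cst Z) Zlim).
have N_gt1 : (1 < N)%N by lia.
have val (i : 'I_N) : complex.Re (omega R n ^+ (i * j)) = xs.
  have /matrixP/(_ (lshift N i) ord0) := Zgp.
  by rewrite /gathering_point !col_mxEu !mxE.
(* Entries 0 and 1 of Re v_j differ: the first is 1, the second less than 1. *)
have := @Re_omegaX_lt1 R n j jN.
have := val (Ordinal N_gt1); rewrite /= mul1n => ->.
by have := val ord0; rewrite mul0n expr0 /= => <-; rewrite ltxx.
Qed.

(** Since lambda_0 is the sum of the weights, which is 1, the mode 0 neither decays nor rotates. *)
Lemma dft0_cst (X : R -> 'cV[R]_N) :
  (forall i, {within `[0, +oo[, continuous (fun t => X t i 0)}) ->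
  (forall t : R, 0 < t -> forall i,
    is_derive t 1 (fun s => X s i 0) ((circ w *m X t - X t) i 0)) ->
  forall t : R, 0 <= t -> dft (X t) 0 = dft (X 0) 0.
Proof.
move=> cX dX t t0; rewrite (dft_solution cX dX) // /alpha lambda0.
rewrite gathering_sum //= addNr !mul0r expR0 cexp_i cos0 sin0.
by rewrite [X in X * _](_ : _ = 1) // [X in _ * (X * _)](_ : _ = 1) // !mul1r.
Qed.

Lemma solution_modes (k : nat) (X : R -> 'cV[R]_N) :
  N = k.*2 \/ N = k.*2.+1 ->
  (forall i, {within `[0, +oo[, continuous (fun t => X t i 0)}) ->
  (forall t : R, 0 < t -> forall i,
    is_derive t 1 (fun s => X s i 0) ((circ w *m X t - X t) i 0)) ->
  forall (t : R) (i : 'I_N), 0 <= t ->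
    X t i 0 = N%:R^-1 * \sum_l X 0 l 0 +
      \sum_(1 <= j < k.+1) alpha w j t *
        (complex.Re (mode w (X 0) j t * omega R n ^+ (i * j)) *+
          (if N == j.*2 then 1 else 2)).
Proof.
move=> hk cX dX t i t0; rewrite (fourier_real _ _ hk) dft0_cst // dft0 /=.
congr (_ + _); apply: eq_bigr => j _.
by rewrite (dft_solution cX dX) // -mulrA ReM /= mul0r subr0 mulrnAr.
Qed.

(** The mean tends to [xs] and is conserved, so uniqueness of limits identifies [xs] with the
    initial mean. *)
Lemma mean_limit (X : R -> 'cV[R]_N) (xs : R) :
  (forall i, {within `[0, +oo[, continuous (fun t => X t i 0)}) ->
  (forall t : R, 0 < t -> forall i,
    is_derive t 1 (fun s => X s i 0) ((circ w *m X t - X t) i 0)) ->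
  (forall i, X t i 0 @[t --> +oo] --> xs) ->
  xs = N%:R^-1 * \sum_i X 0 i 0.
Proof.
move=> cX dX Xlim.
pose m (x : 'cV[R]_N) : R := \sum_(i < N) N%:R^-1 * x i 0.
have mE x : m x = complex.Re (dft x 0) by rewrite dft0 /= mulr_sumr.
have mlim : m (X t) @[t --> +oo] --> \sum_(i < N) N%:R^-1 * xs.
  exact: cvg_lincomb.
have mlim0 : m (X t) @[t --> +oo] --> m (X 0).
  apply: cvg_near_cst; exists 0; split => // t t0.
  by rewrite !mE dft0_cst // ltW.
have : \sum_(i < N) N%:R^-1 * xs = m (X 0) by apply: (cvg_unique _ mlim mlim0).
rewrite {1}/m -[in RHS]mulr_sumr => <-.
by rewrite -mulr_sumr sumr_const card_ord -[xs *+ N]mulr_natl mulKf ?pnatr_eq0.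
Qed.

End Gathering.

(** * Splitting the system into its X and Y blocks *)

Section Blocks.
Variables (R : realType) (n : nat) (w : 'I_n.+1 -> R).
Variables (Z0 : 'cV[R]_(n.+1 + n.+1)) (Z : R -> 'cV[R]_(n.+1 + n.+1)).
Hypothesis hZ : cld_solution w Z0 Z.

Lemma cld_coord_continuous (l : 'I_(n.+1 + n.+1)) :
  {within `[0, +oo[, continuous (fun t => Z t l 0)}.
Proof.
have [_ cZ _] := hZ.
move=> t; exact: (cvg_comp _ _ (cZ t) (@coord_continuous _ _ _ l 0 (Z t))).
Qed.

Lemma usubmx_continuous (i : 'I_n.+1) :
  {within `[0, +oo[, continuous (fun t => usubmx (Z t) i 0)}.
Proof.
rewrite (_ : (fun _ => _) = fun t => Z t (lshift _ i) 0); last first.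
  by apply/funext => t; rewrite mxE.
exact: cld_coord_continuous.
Qed.

Lemma dsubmx_continuous (i : 'I_n.+1) :
  {within `[0, +oo[, continuous (fun t => dsubmx (Z t) i 0)}.
Proof.
rewrite (_ : (fun _ => _) = fun t => Z t (rshift _ i) 0); last first.
  by apply/funext => t; rewrite mxE.
exact: cld_coord_continuous.
Qed.

Lemma usubmx_is_derive (t : R) : 0 < t -> forall i : 'I_n.+1,
  is_derive t 1 (fun s => usubmx (Z s) i 0)
    ((circ w *m usubmx (Z t) - usubmx (Z t)) i 0).
Proof.
move=> t0 i; have [_ _ /(_ t t0)/(is_derive_coord (lshift _ i) 0)] := hZ.
rewrite cld_mx_mul col_mxEu; congr is_derive.
by apply/funext => s; rewrite mxE.
Qed.

Lemma dsubmx_is_derive (t : R) : 0 < t -> forall i : 'I_n.+1,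
  is_derive t 1 (fun s => dsubmx (Z s) i 0)
    ((circ w *m dsubmx (Z t) - dsubmx (Z t)) i 0).
Proof.
move=> t0 i; have [_ _ /(_ t t0)/(is_derive_coord (rshift _ i) 0)] := hZ.
rewrite cld_mx_mul col_mxEd; congr is_derive.
by apply/funext => s; rewrite mxE.
Qed.

End Blocks.

(** * Assembling the decomposition of the solution *)

Theorem corollary4p10 (R : realType) (n k : nat)
    (hk : n.+1 = k.*2 \/ n.+1 = k.*2.+1)
    (w : 'I_n.+1 -> R) (w_ge0 : forall i, 0 <= w i)
    (hw : gathering w)
    (Z0 : 'cV[R]_(n.+1 + n.+1)) (Z : R -> 'cV[R]_(n.+1 + n.+1))
    (hZ : cld_solution w Z0 Z) :
  exists (xs ys : R)
         (Xi : nat -> R -> 'cV[R]_(n.+1 + n.+1))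
         (beta : forall j : nat, R -> 'cV[R]_(dimV R n j)),
    [/\ forall t : R, 0 <= t ->
          Z t = gathering_point n xs ys
                + \sum_(1 <= j < k.+1) alpha w j t *: Xi j t,
        Z t @[t --> +oo] --> gathering_point n xs ys,
        xs = n.+1%:R^-1 * \sum_(i < n.+1) usubmx Z0 i 0 /\
        ys = n.+1%:R^-1 * \sum_(i < n.+1) dsubmx Z0 i 0,
        forall j : nat, (1 <= j <= k)%N -> -1 + complex.Re (lambda w j) < 0 &
        forall (j : nat) (t : R), (1 <= j <= k)%N -> 0 <= t ->
          [/\ Xi j t \in V R n j,
              Xi j t = Vmx R n j *m beta j t &
              norm2 (beta j t) = norm2 (beta j 0)]].
Proof.
have cX := usubmx_continuous hZ; have dX := usubmx_is_derive hZ.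
have cY := dsubmx_continuous hZ; have dY := dsubmx_is_derive hZ.
have [Z0E _ _] := hZ.
(* Gathering supplies the limit point; conservation of the mean then determines its coordinates. *)
have [xs [ys Zlim]] := hw.1 _ _ hZ.
have coordlim l : Z t l 0 @[t --> +oo] --> gathering_point n xs ys l 0.
  exact: (cvg_comp _ _ Zlim (@coord_continuous _ _ _ l 0 _)).
have ulim i : usubmx (Z t) i 0 @[t --> +oo] --> xs.
  under eq_fun do rewrite mxE.
  by have := coordlim (lshift _ i); rewrite /gathering_point col_mxEu mxE.
have dlim i : dsubmx (Z t) i 0 @[t --> +oo] --> ys.
  under eq_fun do rewrite mxE.
  by have := coordlim (rshift _ i); rewrite /gathering_point col_mxEd mxE.
have xsE := mean_limit hw cX dX ulim; have ysE := mean_limit hw cY dY dlim.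
(* The coordinates of the j-th modes of both blocks after removal of alpha_j. *)
pose beta j t : 'cV[R]_(dimV R n j) := coord_col n j
  (mode w (usubmx (Z 0)) j t) (mode w (dsubmx (Z 0)) j t).
exists xs, ys, (fun j t => Vmx R n j *m beta j t), beta; split => //.
- move=> t t0; apply/colP => l.
  rewrite mxE summxE.
  under eq_bigr => j _.
    rewrite mxE Vmx_coord_col; last first.
      by move=> Nj; split; [have [] := mode_half w (usubmx (Z 0)) t Nj
                           |have [] := mode_half w (dsubmx (Z 0)) t Nj].
    rewrite mulmxnE.
  over.
  case: (split_ordP l) => i ->.
    have -> : Z t (lshift n.+1 i) 0 = usubmx (Z t) i 0 by rewrite mxE.
    rewrite (solution_modes hw hk cX dX) // /gathering_point col_mxEu mxE xsE.
    by congr (_ + _); apply: eq_bigr => j _; rewrite col_mxEu mxE.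
  have -> : Z t (rshift n.+1 i) 0 = dsubmx (Z t) i 0 by rewrite mxE.
  rewrite (solution_modes hw hk cY dY) // /gathering_point col_mxEd mxE ysE.
  by congr (_ + _); apply: eq_bigr => j _; rewrite col_mxEd mxE.
- by rewrite xsE ysE Z0E.
- move=> j jk; rewrite addrC subr_lt0; apply: Re_lambda_lt1 => //.
  (* From 1 <= j <= k follows j < N, also when N = 2k. *)
  by case: hk => ->; lia.
- move=> j t jk t0; split => //; first exact: Vmx_mul_in_V.
  exact: norm2_coord_col_mode.
Qed.
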